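(* Let $k\ge 5$. For any $K_k$-minor-free multigraph $G$ of maximum degree $\Delta$ such that every two of its edges are incident or joined by an edge, the strong clique number of $G$ satisfies $\omega_2'(G)\le (k-\frac12)\Delta$.
   Context: Multigraphs may have parallel edges; degree counts multiplicity. A multigraph is $K_k$-minor-free if its underlying simple graph has no $K_k$ minor. Two edges are incident if they share an endpoint (parallel edges are incident); they are joined by an edge if some edge of $G$ has one endpoint in common with each of them. A strong clique is a set of edges every two of which are incident or joined by an edge; the strong clique number $\omega_2'(G)$ is the maximum size of a strong clique. *)

(* Defs.v *)
From mathcomp Require Import all_boot.

Set Implicit Arguments.
Unset Strict Implicit.
Unset Printing Implicit Defensive.

Record sgraph := SGraph {
  svertex :> finType;
  sadj : rel svertex;
  sadj_sym : symmetric sadj;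
  sadj_irr : irreflexive sadj }.

Lemma neq_sym (T : eqType) : symmetric (fun x y : T => x != y).
Proof. by move=> x y; rewrite eq_sym. Qed.

Lemma neq_irr (T : eqType) : irreflexive (fun x y : T => x != y).
Proof. by move=> x; rewrite eqxx. Qed.

Definition complete_graph (n : nat) : sgraph :=
  SGraph (@neq_sym 'I_n) (@neq_irr 'I_n).

(* The subgraph of G induced by A is connected; the empty set is excluded. *)
Definition connected_set (G : sgraph) (A : {set G}) : Prop :=
  A != set0 /\
  {in A &, forall x y, connect [rel u v in A | sadj u v] x y}.

(* H is a minor of G, in terms of branch sets: B x is the set of vertices of G
   contracted to the vertex x of H. *)
Definition is_minor (H G : sgraph) : Prop :=
  exists B : H -> {set G},
    [/\ forall x, connected_set (B x),
        forall x y, x != y -> [disjoint B x & B y]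
      & forall x y, sadj x y ->
          exists u v, [/\ u \in B x, v \in B y & sadj u v]].

(* Finite loopless multigraphs: distinct edges may have the same ends. *)
Record multigraph := Multigraph {
  vertex : finType;
  edge : finType;
  ends : edge -> {set vertex};
  card_ends : forall e, #|ends e| = 2 }.

Section Multigraph.
Variable G : multigraph.
Implicit Types (x y : vertex G) (e f g : edge G) (S : {set edge G}).

Definition degree x : nat := #|[set e | x \in ends e]|.

Definition max_degree : nat := \max_(x : vertex G) degree x.

Definition adjacent x y : bool := [exists e : edge G, ends e == [set x; y]].

Lemma adjacent_sym : symmetric adjacent.
Proof. by move=> x y; apply: eq_existsb => e; rewrite setUC. Qed.

Lemma adjacent_irr : irreflexive adjacent.
Proof.
move=> x; apply/negbTE/existsPn => e; apply/eqP => ends_e.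
by have := card_ends e; rewrite ends_e setUid cards1.
Qed.

Definition underlying : sgraph := SGraph adjacent_sym adjacent_irr.

Definition incident e f : bool := ends e :&: ends f != set0.

Definition joined e f : bool := [exists g, incident g e && incident g f].

Definition strong_clique S : bool :=
  [forall e in S, forall f in S, (e != f) ==> incident e f || joined e f].

Definition strong_clique_number : nat := \max_(S | strong_clique S) #|S|.

End Multigraph.

Definition minor_free (k : nat) (G : multigraph) : Prop :=
  ~ is_minor (complete_graph k) (underlying G).

(* Main.v *)
(** A matching in a graph where any two edges are incident or joined contracts
to a clique minor, so the matching number nu is at most k - 1.  It remains to
find a half-integral vertex cover of weight at most nu + 1/2, as such a cover
bounds the number of edges by (nu + 1/2) Delta.  It is described by vertex sets
A (weight 1) and I (weight 0), the other vertices having weight 1/2, where all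
neighbours of I lie in A.  As in the Tutte-Berge formula, a vertex that no
maximum matching misses is put into A and an isolated vertex is put into I.
When no such vertices are left, Gallai's lemma applies: "no maximum matching
misses both u and v" is an equivalence relation that contains adjacency, and
any two edges being close makes all vertices equivalent, so that a maximum
matching misses at most one vertex. *)
Require Import Defs.
From mathcomp Require Import all_boot all_order all_algebra.
From mathcomp Require Import zify.
Import Order.TTheory GRing.Theory Num.Theory.

(** * Matchings as involutions and their missed vertices *)

Section Matching.
Variables (T : finType) (adj : rel T).
Hypothesis adjC : symmetric adj.
Implicit Types (S O A I : {set T}) (s M N : {ffun T -> T}) (x y t u v : T).

(* A matching is encoded as an involution exchanging the ends of its edges. *)
Definition matching_on S s : bool :=
  [forall x, (s (s x) == x) && ((s x != x) ==> (x \in S) && adj x (s x))].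

Definition missed S s : {set T} := [set x in S | s x == x].

(** Missing the fewest vertices of [S] amounts to having the most edges, because [S] consists of the
    missed vertices and two vertices per edge. *)
Definition maximum S s : bool :=
  matching_on S s &&
  [forall s', matching_on S s' ==> (#|missed S s| <= #|missed S s'|)].

Definition matching_edges s : {set {set T}} :=
  [set [set x; s x] | x in [set x | s x != x]].

Lemma matching_onP S s :
  reflect ((forall x, s (s x) = x) /\
           (forall x, s x != x -> x \in S /\ adj x (s x)))
          (matching_on S s).
Proof.
apply: (iffP forallP) => [ms | [invs adjs] x].
  split=> x; have /andP[/eqP invs /implyP adjs] := ms x; first by [].
  by move=> /adjs /andP.
rewrite invs eqxx /=; apply/implyP => /adjs [xS axs].
by rewrite xS axs.
Qed.

Lemma maximumP S s :
  reflect (matching_on S s /\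
           forall s', matching_on S s' -> #|missed S s| <= #|missed S s'|)
          (maximum S s).
Proof.
apply: (iffP andP) => -[ms mins]; split=> //.
  by move=> s' ms'; apply: (implyP (forallP mins s')).
by apply/forallP => s'; apply/implyP => /mins.
Qed.

Lemma maximum_exists S : exists s, maximum S s.
Proof.
have m0 : matching_on S [ffun x => x].
  by apply/matching_onP; split=> x; rewrite !ffunE // eqxx.
case: (arg_minnP (fun s => #|missed S s|) m0) => s ms mins.
by exists s; apply/maximumP.
Qed.

Lemma matching_on_sub S S' s :
  S \subset S' -> matching_on S s -> matching_on S' s.
Proof.
move=> sub /matching_onP [invs adjs]; apply/matching_onP; split=> // x /adjs.
by case=> /(subsetP sub).
Qed.

Lemma partition_matching_edges S s :
  matching_on S s -> partition (matching_edges s) [set x | s x != x].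
Proof.
move=> /matching_onP [invs _]; apply/and3P; split.
- apply/eqP/setP => x; rewrite inE; apply/bigcupP/idP.
    move=> [_ /imsetP[y ny ->]]; rewrite inE in ny; rewrite !inE.
    by case/orP => /eqP -> //; rewrite invs eq_sym.
  move=> nx; exists [set x; s x]; last by rewrite set21.
  by apply: imset_f; rewrite inE.
- apply/trivIsetP => _ _ /imsetP[x _ ->] /imsetP[y _ ->] neq.
  apply/pred0P => z /=; apply/negP => /andP[]; rewrite !inE => zx zy.
  case/negP: neq; apply/eqP/setP => w; rewrite !inE.
  case/orP: zx => /eqP zx; case/orP: zy => /eqP zy.
  + by rewrite -zx -zy.
  + by rewrite -zx zy invs orbC.
  + by rewrite -zy zx invs orbC.
  + by rewrite -zx -zy -(invs x) -zx zy invs.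
- apply/imsetP => -[x _ /setP /(_ x)]; by rewrite !inE eqxx.
Qed.

Lemma card_matching_edges S s :
  matching_on S s -> #|S| = #|missed S s| + #|matching_edges s| * 2.
Proof.
move=> ms; rewrite -(card_uniform_partition _ (partition_matching_edges _ _ ms)).
  have /matching_onP [_ adjs] := ms.
  rewrite -(cardsID [set x | s x == x] S); congr (_ + _); apply: eq_card => x.
    by rewrite !inE.
  by rewrite !inE; case: eqP => //= /eqP /adjs [].
move=> _ /imsetP[x xn ->]; rewrite inE in xn.
by rewrite cards2 eq_sym xn.
Qed.

(** * Exchanging two matchings along an alternating component *)

Definition swap O M N : {ffun T -> T} := [ffun x => if x \in O then N x else M x].

Lemma matching_swap S O M N :
    matching_on S M -> matching_on S N ->
    (forall x, (M x \in O) = (x \in O)) -> (forall x, (N x \in O) = (x \in O)) ->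
  matching_on S (swap O M N).
Proof.
move=> /matching_onP [invM adjM] /matching_onP [invN adjN] clM clN.
apply/matching_onP; split=> x; rewrite !ffunE.
  by case xO: (x \in O); rewrite ?clM ?clN xO ?invM ?invN.
by case: ifP => _; [apply: adjN | apply: adjM].
Qed.

Lemma card_missed_swap S O M N :
  #|missed S (swap O M N)| = #|missed S N :&: O| + #|missed S M :\: O|.
Proof.
rewrite -(cardsID O (missed S (swap O M N))).
by congr (_ + _); apply: eq_card => x; rewrite !inE ffunE; case: (x \in O);
  rewrite ?andbF ?andbT.
Qed.

(** The opposite exchange [swap O N M] is a matching too, so minimality of [N] shows that [N] misses
    at most as many vertices inside [O] as [M] does. Hence replacing [M] by [N] on [O] loses
    nothing. *)
Lemma maximum_swap S O M N :
    maximum S M -> maximum S N ->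
    (forall x, (M x \in O) = (x \in O)) -> (forall x, (N x \in O) = (x \in O)) ->
  maximum S (swap O M N).
Proof.
move=> /maximumP [mM minM] /maximumP [mN minN] clM clN.
apply/maximumP; split; first exact: matching_swap.
move=> s' /minM; apply: leq_trans.
have := minN _ (matching_swap _ _ _ _ mN mM clN clM).
rewrite !card_missed_swap -(cardsID O (missed S N)) -(cardsID O (missed S M)).
by rewrite leq_add2r leq_add2r.
Qed.

(** Otherwise the edge between [u] and [v] could be added to the matching. *)
Lemma maximum_not_adj S s u v :
  maximum S s -> u \in missed S s -> v \in missed S s -> u != v -> ~~ adj u v.
Proof.
move=> /maximumP [/matching_onP [invs adjs] mins].
rewrite !inE => /andP[uS /eqP su] /andP[vS /eqP sv] nuv; apply/negP => auv.
pose s' := [ffun x => if x == u then v else if x == v then u else s x].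
have ms' : matching_on S s'.
  apply/matching_onP; split=> x; rewrite !ffunE.
    case: (eqVneq x u) => [-> | xu]; first by rewrite eq_sym (negPf nuv) eqxx.
    case: (eqVneq x v) => [-> | xv]; first by rewrite eqxx.
    rewrite -{1}su (inj_eq (can_inj invs)) (negPf xu).
    by rewrite -{1}sv (inj_eq (can_inj invs)) (negPf xv).
  case: (eqVneq x u) => [-> // | xu].
  by case: (eqVneq x v) => [-> _ | xv]; [rewrite adjC | apply: adjs].
have: missed S s' \proper missed S s.
  apply/properP; split; last first.
    exists u; rewrite !inE ?su ?uS ?eqxx //= ffunE eqxx eq_sym.
    by rewrite (negPf nuv).
  apply/subsetP => x; rewrite !inE ffunE => /andP[-> /=].
  case: (eqVneq x u) => [-> | _]; [by rewrite su eqxx | case: (eqVneq x v) => [-> | //]].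
  by rewrite sv eqxx.
by move=> /proper_card; rewrite ltnNge mins.
Qed.

(* The O below is the vertex set of the component of t in the union of M and N,
   a path starting at t; its only other end is the only vertex of O that can be
   fixed by M. *)
Lemma alternating_component M N t :
    (forall x, M (M x) = x) -> (forall x, N (N x) = x) -> N t = t ->
  exists O, [/\ t \in O,
    forall x, (M x \in O) = (x \in O),
    forall x, (N x \in O) = (x \in O)
    & {in O &, forall u v, M u = u -> M v = v -> u = v}].
Proof.
move=> invM invN Nt; pose f x := N (M x).
have injf : injective f by move=> x y /(can_inj invN) /(can_inj invM).
(* Conjugation by [N] inverts [f], and [N] fixes [t]; so [N] reflects the orbit of [t], sending the
   [i]-th iterate to the one of index [-i]. *)
have iterN i : iter i f (N (iter i f t)) = t.
  elim: i => //= i IHi; rewrite -iterS iterSr.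
  by rewrite /f invN invM.
have closed (h : T -> T) : (forall x, h (h x) = x) ->
    (forall x, fconnect f t x -> fconnect f t (h x)) ->
    forall x, (h x \in [set x | fconnect f t x]) = (x \in [set x | fconnect f t x]).
  move=> invh clh x; rewrite !inE; apply/idP/idP => /clh //.
  by rewrite invh.
have clN x : fconnect f t x -> fconnect f t (N x).
  move=> /iter_findex <-; set i := findex _ _ _.
  by rewrite fconnect_sym // -{2}(iterN i) fconnect_iter.
exists [set x | fconnect f t x]; split.
- by rewrite inE connect0.
- apply: closed => // x cx; rewrite -(invN (M x)); apply: clN.
  exact: connect_trans cx (fconnect1 f x).
- exact: closed.
(* If [M] fixes the [i]-th iterate, then [N] sends the iterate of index [i.+1] back to that of index
   [i], so the reflection [iterN] gives the period [2i + 1]. *)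
have period i : M (iter i f t) = iter i f t -> iter i.*2.+1 f t = t.
  move=> Mi; rewrite -{2}(iterN i.+1) /= {2}/f invN Mi.
  by rewrite -iterS -iterD addSn addnn.
have periodM i j : iter i f t = t -> iter (j * i) f t = t.
  by move=> ti; elim: j => // j IHj; rewrite mulSn iterD IHj.
move=> u v; rewrite !inE => /iter_findex <- /iter_findex <-.
move: (findex f t u) (findex f t v) => i j /period ti /period tj.
(* Going round [j] periods of length [2i + 1] on one side and [i] periods of length [2j + 1] on the
   other makes both exponents [i + j + 2ij]. *)
rewrite -{1}(periodM _ j ti) -{2}(periodM _ i tj) -!iterD; congr iter; lia.
Qed.

(** * Gallai's lemma and half-integral covers *)

Definition gallai_equiv S u v :=
  u = v \/ forall s, maximum S s -> ~~ ((u \in missed S s) && (v \in missed S s)).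

(** Suppose [M] misses [u] and [v]. Exchanging [M] for [N] on the component of [t] yields a maximum
    matching that misses [t]. The component contains at most one of [u] and [v], so the other one is
    still missed, against one of the two assumptions. *)
Lemma gallai_equiv_trans S t u v :
    (exists2 N, maximum S N & t \in missed S N) ->
  gallai_equiv S u t -> gallai_equiv S t v -> gallai_equiv S u v.
Proof.
move=> [N maxN]; rewrite inE => /andP[tS /eqP Nt].
case=> [-> // | ut] [<- | tv]; first by right.
case: (eqVneq u v) => [-> | nuv]; [by left | right=> M maxM].
apply/negP => /andP[]; rewrite !inE => /andP[uS /eqP Mu] /andP[vS /eqP Mv].
have /maximumP[/matching_onP[invM _] _] := maxM.
have /maximumP[/matching_onP[invN _] _] := maxN.
have [O [tO clM clN uniqO]] := alternating_component M N t invM invN Nt.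
have max' := maximum_swap _ _ _ _ maxM maxN clM clN.
have := ut _ max'; have := tv _ max'.
rewrite !inE !ffunE tO Nt tS uS vS eqxx /= andbT.
case: ifP => vO; last by rewrite Mv eqxx.
case: ifP => uO; last by rewrite Mu eqxx.
by rewrite (uniqO u v) ?eqxx // in nuv.
Qed.

Definition edges_close :=
  forall a b c d, adj a b -> adj c d ->
  exists x y, [/\ x \in [set a; b], y \in [set c; d] & x = y \/ adj x y].

Hypothesis close : edges_close.

Lemma gallai_lemma S s :
    (forall v, v \in S -> exists2 N, maximum S N & v \in missed S N) ->
    (forall v, v \in S -> exists2 w, w \in S & adj v w) ->
  maximum S s -> #|missed S s| <= 1.
Proof.
move=> allmissed noisol maxs.
have equiv_adj x y : x = y \/ adj x y -> gallai_equiv S x y.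
  case=> [-> | axy]; first by left.
  case: (eqVneq x y) => [-> | nxy]; [by left | right=> s' max'].
  by apply/negP => /andP[xm ym]; have := maximum_not_adj _ _ _ _ max' xm ym nxy;
    rewrite axy.
rewrite leqNgt; apply/negP => /card_gt1P [u [v [um vm nuv]]].
have uS : u \in S by move: um; rewrite inE => /andP[].
have vS : v \in S by move: vm; rewrite inE => /andP[].
have [u' u'S auu'] := noisol u uS; have [v' v'S avv'] := noisol v vS.
have [x [y [xu yv axy]]] := close _ _ _ _ auu' avv'.
have ux : gallai_equiv S u x.
  by apply: equiv_adj; move: xu; rewrite !inE => /orP[] /eqP ->; auto.
have yv' : gallai_equiv S y v.
  by apply: equiv_adj; move: yv; rewrite !inE adjC in avv' * => /orP[] /eqP ->; auto.
have xS : x \in S by move: xu; rewrite !inE => /orP[] /eqP ->.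
have yS : y \in S by move: yv; rewrite !inE => /orP[] /eqP ->.
have uv : gallai_equiv S u v.
  apply: gallai_equiv_trans (allmissed x xS) ux _.
  exact: gallai_equiv_trans (allmissed y yS) (equiv_adj _ _ axy) yv'.
by case: uv => [e | /(_ s maxs)]; [rewrite e eqxx in nuv | rewrite um vm].
Qed.

Lemma missed_setD1 S s v :
  v \in S -> matching_on (S :\ v) s -> #|missed S s| = #|missed (S :\ v) s|.+1.
Proof.
move=> vS /matching_onP [_ adjs]; have sv : s v == v.
  by apply/negPn/negP => /adjs []; rewrite !inE eqxx.
rewrite (cardsD1 v) inE vS sv add1n; congr _.+1.
by apply: eq_card => x; rewrite !inE andbA.
Qed.

(* Twice the weight of the half-integral cover is #|S| + #|A| - #|I|, and twice
   the matching number is #|S| - #|missed S s|. *)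
Lemma half_integral_cover S s :
  maximum S s ->
  exists A I, [/\ I \subset S,
    forall x y, x \in I -> y \in S -> adj x y -> y \in A
    & #|A| + #|missed S s| <= #|I|.+1].
Proof.
have [n] := ubnP #|S|; elim: n => // n IHn in S s *; rewrite ltnS => leSn maxs.
have /maximumP[ms mins] := maxs.
(* First case: every maximum matching covers [v], which then joins [A]. *)
have [/exists_inP[v vS /forallP cov] | /exists_inPn missable] :=
  boolP [exists v in S, [forall s', maximum S s' ==> (s' v != v)]].
  have [s' max'] := maximum_exists (S :\ v).
  have [|A [I [IS AI cardAI]]] := IHn (S :\ v) s' _ max'.
    by move: leSn; rewrite (cardsD1 v) vS.
  have /maximumP[ms' _] := max'.
  have mS' := matching_on_sub _ _ _ (subD1set S v) ms'.
  exists (v |: A), I; split.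
  - exact: subset_trans IS (subD1set S v).
  - move=> x y xI yS axy; rewrite !inE; case: eqVneq => //= nyv.
    by apply: AI axy; rewrite ?inE ?nyv.
  have lt : #|missed S s| < #|missed S s'|.
    rewrite ltnNge; apply/negP => le.
    have: maximum S s'.
      by apply/maximumP; split=> // s'' /mins; apply: leq_trans.
    move=> /(implyP (cov s')); have /matching_onP[_ adjs] := ms'.
    by move=> /adjs []; rewrite !inE eqxx.
  (* By parity the strict inequality [lt] is a gap of at least two. One unit makes up for [s']
     missing [v] in [S], the other pays for the new element of [A]. *)
  have := card_matching_edges _ _ ms; have := card_matching_edges _ _ mS'.
  have := cardsU1 v A; have := leq_b1 (v \notin A).
  move: lt; rewrite (missed_setD1 _ _ _ vS ms'); lia.
(* Second case: [v] is isolated in [S] and joins [I]; this offsets the at most one additional missed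
   vertex. *)
have [/exists_inP[v vS /forall_inP isol] | /exists_inPn noisol] :=
  boolP [exists v in S, [forall w in S, ~~ adj v w]].
  have [s' max'] := maximum_exists (S :\ v).
  have [|A [I [IS AI cardAI]]] := IHn (S :\ v) s' _ max'.
    by move: leSn; rewrite (cardsD1 v) vS.
  have /maximumP[ms' _] := max'.
  exists A, (v |: I); split.
  - by rewrite subUset sub1set vS (subset_trans IS) // subD1set.
  - move=> x y; rewrite in_setU1 => /predU1P[-> /isol/negPf -> // | xI yS axy].
    apply: (AI x y xI _ axy); rewrite !inE yS andbT; apply/eqP => yv; subst y.
    have xS : x \in S by have := subsetP IS _ xI; rewrite !inE => /andP[].
    by have := isol x xS; rewrite adjC axy.
  have vI : v \notin I.
    by apply/negP => /(subsetP IS); rewrite !inE eqxx.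
  have := mins _ (matching_on_sub _ _ _ (subD1set S v) ms').
  by rewrite (missed_setD1 _ _ _ vS ms') cardsU1 vI; lia.
(* Last case: all weights are one half, and the bound is exactly that of [gallai_lemma]. *)
exists set0, set0; split; rewrite ?sub0set ?cards0 //.
  by move=> x y; rewrite inE.
apply: gallai_lemma maxs => v vS.
  have := missable v vS; rewrite negb_forall => /existsP[N].
  by rewrite negb_imply negbK => /andP[maxN Nv]; exists N; rewrite // inE vS.
have := noisol v vS; rewrite negb_forall => /existsP[w].
by rewrite negb_imply negbK => /andP[]; exists w.
Qed.

End Matching.

(** * From strong multigraphs to clique minors and degree sums *)

Section StrongMultigraph.
Variable G : multigraph.

Lemma ends_adjacent (e : edge G) :
  exists x y, ends e = [set x; y] /\ adjacent x y.
Proof.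
have /eqP/cards2P[x [y [_ exy]]] := card_ends e.
by exists x, y; split=> //; apply/existsP; exists e; rewrite exy.
Qed.

Lemma sum_degree (A : {set vertex G}) :
  \sum_(x in A) degree x = \sum_(e : edge G) #|ends e :&: A|.
Proof.
under eq_bigr do rewrite /degree -sum1_card big_mkcond /=.
rewrite exchange_big /=; apply: eq_bigr => e _.
rewrite -sum1_card -big_mkcondr /=; apply: eq_bigl => x.
by rewrite !inE andbC.
Qed.

Hypothesis strong : forall e f : edge G, e != f -> incident e f || joined e f.

Lemma strong_edges_close : edges_close (vertex G) (@adjacent G).
Proof.
move=> a b c d /existsP[e /eqP <-] /existsP[f /eqP <-].
have shared : incident e f -> exists x y,
    [/\ x \in ends e, y \in ends f & x = y \/ adjacent x y].
  by move=> /set0Pn[x /setIP[xe xf]]; exists x, x; split=> //; left.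
have [ef | /strong /orP[// | /existsP[g /andP[]]]] := eqVneq e f.
  by apply: shared; rewrite /incident ef setIid -card_gt0 card_ends.
move=> /set0Pn[x /setIP[xg xe]] /set0Pn[y /setIP[yg yf]].
exists x, y; split=> //; have [-> | nxy] := eqVneq x y; [by left | right].
apply/existsP; exists g; rewrite eq_sym eqEcard subUset !sub1set xg yg.
by rewrite card_ends cards2 nxy.
Qed.

(** The branch sets are [k] of the matching edges. As they are disjoint, closeness of two of them
    can only mean adjacency of an end of one to an end of the other. *)
Lemma matching_minor k S s :
    matching_on (vertex G) (@adjacent G) S s ->
    k <= #|matching_edges (vertex G) s| ->
  is_minor (complete_graph k) (underlying G).
Proof.
move=> ms kP; pose B i := enum_val (widen_ord kP i).
have BP i : exists2 x, s x != x & B i = [set x; s x].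
  by have /imsetP[x] := enum_valP (widen_ord kP i); rewrite inE; exists x.
have /matching_onP[_ adjs] := ms.
have /and3P[_ /trivIsetP triv _] := partition_matching_edges _ _ _ _ ms.
exists B; split=> [i | i j nij | i j nij].
- have [x nx ->] := BP i; have [_ axs] := adjs x nx; split.
    by apply/set0Pn; exists x; rewrite set21.
  move=> u v ue ve; case: (eqVneq u v) => [-> | nuv]; first exact: connect0.
  apply: connect1; rewrite /= ue ve /=.
  by move: ue ve nuv; rewrite !inE => /orP[] /eqP -> /orP[] /eqP ->;
    rewrite ?eqxx // adjacent_sym.
- apply: triv; rewrite ?enum_valP //.
  by rewrite (inj_eq enum_val_inj) -val_eqE.
have dis : [disjoint B i & B j].
  apply: triv; rewrite ?enum_valP //.
  by rewrite (inj_eq enum_val_inj) -val_eqE.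
have [x nx Bi] := BP i; have [y ny Bj] := BP j.
have [_ ax] := adjs x nx; have [_ ay] := adjs y ny.
have [u [v [uB vB uv]]] := strong_edges_close _ _ _ _ ax ay.
rewrite -Bi -Bj in uB vB.
exists u, v; split=> //; case: uv => // uv.
by have := disjointFr dis uB; rewrite uv vB.
Qed.

(** The degree sum over [I] is at most that over [A], so [2 * #|edge G|] is at most the maximum
    degree times [#|A| + #|~: I|]. This factor is at most twice the matching number plus one, and
    the matching number is below [k]. *)
Lemma card_edge_bound k :
  minor_free k G -> 2 * #|edge G| <= k.*2.-1 * max_degree G.
Proof.
move=> hminor.
have [s maxs] := maximum_exists (vertex G) (@adjacent G) setT.
have [A [I [_ AI cardAI]]] :=
  half_integral_cover _ _ (@adjacent_sym G) strong_edges_close _ _ maxs.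
have /maximumP[ms _] := maxs.
have ltk : #|matching_edges (vertex G) s| < k.
  by rewrite ltnNge; apply/negP => /(matching_minor _ _ _ ms).
have degI : \sum_(x in I) degree x <= \sum_(x in A) degree x.
  rewrite !sum_degree; apply: leq_sum => e _.
  have [x [y [-> axy]]] := ends_adjacent e.
  have nxy : x != y by apply: contraTneq axy => ->; rewrite adjacent_irr.
  have card2 (D : {set vertex G}) :
      #|[set x; y] :&: D| = (x \in D) + (y \in D).
    rewrite setIUl cardsU [X in _ - X](_ : _ = 0) ?subn0; last first.
      apply/eqP; rewrite cards_eq0; apply/eqP/setP => z; rewrite !inE.
      by case: eqVneq => // ->; rewrite (negPf nxy) andbF.
    have card1 z : #|[set z] :&: D| = (z \in D).
      case: (boolP (z \in D)) => zD.
        by rewrite (setIidPl _) ?cards1 ?sub1set.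
      by apply/eqP; rewrite cards_eq0 setI_eq0 disjoints1.
    by rewrite !card1.
  (* The swap pairs each end in [I] with the opposite end of the edge, which lies in [A]. *)
  rewrite !card2 addnC; apply: leq_add; case: (boolP (_ \in I)) => // inI.
    by rewrite (AI y x) // adjacent_sym.
  by rewrite (AI x y).
have sumE : \sum_(x : vertex G) degree x = 2 * #|edge G|.
  rewrite (eq_bigl (fun x => x \in [set: vertex G])); last by move=> x; rewrite inE.
  rewrite sum_degree; under eq_bigr do rewrite setIT card_ends.
  by rewrite sum_nat_const mulnC.
have degD (D : {set vertex G}) : \sum_(x in D) degree x <= #|D| * max_degree G.
  rewrite -sum_nat_const; apply: leq_sum => x _.
  exact: (leq_bigmax (F := @degree G)).
have := card_matching_edges _ _ _ _ ms; rewrite cardsT => cardV.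
have cardC : #|I| + #|~: I| = #|vertex G| by rewrite cardsC.
have split_sum : \sum_(x : vertex G) degree x =
    \sum_(x in I) degree x + \sum_(x in ~: I) degree x.
  rewrite (bigID (fun x => x \in I)) /=; congr (_ + _).
  by apply: eq_bigl => x; rewrite inE.
rewrite -sumE split_sum.
apply: leq_trans (leq_add degI (leqnn _)) _.
apply: leq_trans (leq_add (degD A) (degD (~: I))) _.
rewrite -mulnDl; apply: leq_mul => //; lia.
Qed.

End StrongMultigraph.

(** * The bound over the rationals *)

Local Open Scope ring_scope.

Theorem theorem1p8 (k : nat) (G : multigraph) (Delta : nat)
    (hk : (5 <= k)%N)
    (hminor : minor_free k G)
    (hDelta : max_degree G = Delta)
    (hstrong : forall e f : edge G, e != f -> incident e f || joined e f) :
  (strong_clique_number G)%:R <= (k%:R - 1 / 2%:R) * Delta%:R :> rat.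
Proof.
have clique_le : (strong_clique_number G <= #|edge G|)%N.
  by apply/bigmax_leqP => S _; apply: max_card.
have := card_edge_bound G hstrong k hminor; rewrite hDelta => bound.
have two_gt0 : 0 < 2%:R :> rat by [].
rewrite -(ler_pM2l two_gt0) mulrA mulrBr mul1r divff //.
(* Since [k] is positive, the natural predecessor is not truncated and agrees with subtraction in
   [rat]. *)
have -> : 2%:R * k%:R - 1 = (k.*2.-1)%:R :> rat.
  by rewrite -natrM mul2n -subn1 natrB // double_gt0; apply: leq_trans hk.
rewrite -!natrM ler_nat; apply: leq_trans bound.
by rewrite leq_mul2l.
Qed.
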